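(* Let $m$ and $t$ be positive integers with $t\ge 2$, and put $$q(m,t)=\begin{cases} a(m,t/2) & \text{if } t \text{ is even},\\ a(m,(t-1)/2)+a(m-1,(t-1)/2) & \text{if } t \text{ is odd}.\end{cases}$$ If $G$ is a finite abelian group of order $n$ that contains a $t$-independent set of size $m$, then $n\ge q(m,t)$.
   Context: The numbers $a(m,s)$, for non-negative integers $m,s$, are defined recursively by $a(m,0)=a(0,s)=1$ and, for $m,s\ge 1$, $a(m,s)=a(m-1,s)+a(m,s-1)+a(m-1,s-1)$. Let $G$ be a finite abelian group written additively, $t$ a non-negative integer, and $A=\{a_1,\dots,a_m\}$ a subset of $G$ of size $m$. $A$ is a $t$-independent set in $G$ if, whenever $\lambda_1a_1+\lambda_2a_2+\cdots+\lambda_m a_m=0$ for some integers $\lambda_1,\dots,\lambda_m$ with $|\lambda_1|+|\lambda_2|+\cdots+|\lambda_m|\le t$, we have $\lambda_1=\lambda_2=\cdots=\lambda_m=0$. *)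

(* Defs.v *)
From HB Require Import structures.
From mathcomp Require Import all_boot all_order all_algebra.

Set Implicit Arguments.
Unset Strict Implicit.
Unset Printing Implicit Defensive.

Import GRing.Theory.

(* The numbers a(m, s) (Delannoy numbers). The nested fixpoint only serves
   termination; the recursion is displayed by the three lemmas below. *)
Fixpoint delannoy (m : nat) : nat -> nat :=
  match m with
  | 0 => fun _ => 1
  | m'.+1 => fix delannoy_m (s : nat) : nat :=
      match s with
      | 0 => 1
      | s'.+1 => delannoy m' s'.+1 + delannoy_m s' + delannoy m' s'
      end
  end.

Lemma delannoy0s s : delannoy 0 s = 1.
Proof. by []. Qed.

Lemma delannoym0 m : delannoy m 0 = 1.
Proof. by case: m. Qed.

Lemma delannoySS m s :
  delannoy m.+1 s.+1 = delannoy m s.+1 + delannoy m.+1 s + delannoy m s.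
Proof. by []. Qed.

Definition q (m t : nat) : nat :=
  if odd t then delannoy m (t.-1)./2 + delannoy m.-1 (t.-1)./2
  else delannoy m t./2.

(* The integer coefficients are indexed by the elements of A themselves; the
   values of lam outside A are irrelevant. *)
Definition t_independent (G : finZmodType) (t : nat) (A : {set G}) : Prop :=
  forall lam : G -> int,
    (\sum_(a in A) a *~ lam a)%R = 0%R ->
    \sum_(a in A) `|lam a|%N <= t ->
    forall a, a \in A -> lam a = 0%R.

(* Main.v *)
Require Import Defs.
From mathcomp Require Import all_boot all_order all_algebra.
From mathcomp Require Import zify.

(** If A is t-independent, integer vectors at l1-distance at most t have
distinct linear combinations over A, so #|G| bounds the size of any set of
vectors of l1-diameter at most t. For t = 2s take the l1-ball of radius s,
which has a(m, s) points; for t = 2s + 1 take the union of that ball with its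
translate by the first unit vector, which adds one point on top of each line
parallel to the first axis that meets the ball, i.e. a(m - 1, s) points. *)

Set Implicit Arguments.
Unset Strict Implicit.
Unset Printing Implicit Defensive.

Import GRing.Theory.

Definition l1norm (x : seq int) : nat := \sum_(k <- x) `|k|%N.

Definition l1dist (m : nat) (x y : seq int) : nat :=
  \sum_(i < m) `|(x`_i - y`_i)%R|%N.

Lemma l1norm_cons k x : l1norm (k :: x) = `|k|%N + l1norm x.
Proof. by rewrite /l1norm big_cons. Qed.

Lemma l1norm_nseq0 m : l1norm (nseq m 0%R) = 0.
Proof.
by elim: m => [|m IHm]; [rewrite /l1norm big_nil | rewrite l1norm_cons IHm].
Qed.

Lemma l1dist_cons m k l x y :
  l1dist m.+1 (k :: x) (l :: y) = `|(k - l)%R|%N + l1dist m x y.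
Proof. by rewrite /l1dist big_ord_recl. Qed.

Lemma l1distC m x y : l1dist m x y = l1dist m y x.
Proof. by apply: eq_bigr => i _; rewrite distnC. Qed.

Lemma l1dist_le m x y :
  size x = m -> size y = m -> l1dist m x y <= l1norm x + l1norm y.
Proof.
elim: m x y => [|m IHm] [|k x] [|l y] //=; first by rewrite /l1dist big_ord0.
move=> [sx] [sy]; rewrite l1dist_cons !l1norm_cons.
by have := IHm x y sx sy; lia.
Qed.

Lemma t_independent_size_le (G : finZmodType) (A : {set G}) (t : nat)
    (S : seq (seq int)) :
    t_independent t A -> uniq S ->
    {in S, forall x, size x = #|A|} ->
    {in S &, forall x y, l1dist #|A| x y <= t} ->
  size S <= #|G|.
Proof.
move=> indA uS sizeS distS; set e := enum A.
have se : #|A| = size e by rewrite cardE.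
pose ev (x : seq int) : G := (\sum_(i < #|A|) e`_i *~ x`_i)%R.
have ev_inj : {in S &, injective ev}.
  move=> x y xS yS exy.
  (* Reads [x - y] as coefficients on [A] via positions in [enum A]: their combination is
     [ev x - ev y], which is 0, and their total size is [l1dist #|A| x y]. *)
  pose lam a : int := (x`_(index a e) - y`_(index a e))%R.
  have lamE i : i < #|A| -> lam (e`_i)%R = (x`_i - y`_i)%R.
    by rewrite se => lti; rewrite /lam index_uniq ?enum_uniq.
  have lam0 : forall a, a \in A -> lam a = 0%R.
    apply: indA.
      rewrite -big_enum (big_nth 0%R) big_mkord -/e -se.
      under eq_bigr => i _ do rewrite lamE // mulrzBr.
      by rewrite sumrB; apply/eqP; rewrite subr_eq0; apply/eqP.
    rewrite -big_enum (big_nth 0%R) big_mkord -/e -se.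
    under eq_bigr => i _ do rewrite lamE //.
    exact: distS.
  apply: (@eq_from_nth _ 0%R); first by rewrite !sizeS.
  move=> i; rewrite sizeS // => lti; apply/eqP; rewrite -subr_eq0 -lamE //.
  by rewrite lam0 // -mem_enum mem_nth // -se.
rewrite -(size_map ev) -(card_uniqP _) ?max_card //.
by rewrite map_inj_in_uniq.
Qed.

(** New first entries are at least 1 or at most -2, so 0 and -1 stay free for the other two
    families; the norm grows by exactly 1 on nonempty vectors. *)
Definition stretch_head (x : seq int) : seq int :=
  if x is k :: y then ((if (0 <= k)%R then k + 1 else k - 1)%R :: y) else x.

Lemma stretch_head_inj : injective stretch_head.
Proof.
move=> [|k x] [|l y] //= [ekl ->]; congr (_ :: _).
by move: ekl; case: ifP; case: ifP; lia.
Qed.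

(* In the inductive step the vectors of the ball of radius s.+1 are those with
   first entry 0, those obtained by moving the first entry of a vector of the
   ball of radius s away from 0 (with 0 sent to 1), and those with first entry
   -1; this is the recursion defining delannoy. *)
Lemma l1ball_delannoy m s : exists S : seq (seq int),
  [/\ uniq S, size S = delannoy m s
    & {in S, forall x, size x = m /\ l1norm x <= s}].
Proof.
elim: m s => [|m IHm] s.
  exists [:: [::]]; split=> // x; rewrite inE => /eqP->.
  by rewrite /l1norm big_nil.
elim: s => [|s [S1 [uS1 sS1 S1P]]].
  exists [:: nseq m.+1 0%R]; split=> // x; rewrite inE => /eqP->.
  by rewrite size_nseq l1norm_nseq0.
have [S0 [uS0 sS0 S0P]] := IHm s.+1; have [S2 [uS2 sS2 S2P]] := IHm s.
have cons_inj (k : int) : injective (cons k) by move=> x y [].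
exists (map (cons 0%R) S0 ++ map stretch_head S1 ++ map (cons (-1)%R) S2).
split.
- rewrite !cat_uniq !map_inj_uniq ?uS0 ?uS1 ?uS2 //=; last first.
    exact: stretch_head_inj.
  rewrite andbT; apply/andP; split; apply/hasPn => x.
    rewrite mem_cat => /orP[] /mapP[y yS ->]; apply/mapP => -[z _].
      by case: y yS => [/S1P[]|k y _] //= [+ _]; case: ifP; lia.
    by [].
  move=> /mapP[y _ ->]; apply/mapP => -[[|k z] // _] /= [+ _].
  by case: ifP; lia.
- by rewrite !size_cat !size_map sS0 sS1 sS2 delannoySS addnA.
- move=> x; rewrite !mem_cat => /or3P[] /mapP[y yS ->] /=.
  + by have [-> ly] := S0P _ yS; rewrite l1norm_cons.
  + have [] := S1P _ yS; case: y {yS} => //= k y [->].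
    by rewrite !l1norm_cons; split=> //; case: ifP; lia.
  + by have [-> ly] := S2P _ yS; rewrite l1norm_cons; split=> //; lia.
Qed.

Lemma l1diameter_odd_delannoy m s : exists S : seq (seq int),
  [/\ uniq S, size S = delannoy m.+1 s + delannoy m s,
      {in S, forall x, size x = m.+1}
    & {in S &, forall x y, l1dist m.+1 x y <= s.*2.+1}].
Proof.
have [B [uB sB BP]] := l1ball_delannoy m.+1 s.
have [C [uC sC CP]] := l1ball_delannoy m s.
(* On the line over [y], the ball ends at first entry [s - l1norm y], a genuine difference for [y]
   in [C]. One step further the norm is exactly [s.+1], hence outside [B]. *)
pose top (y : seq int) : seq int := (Posz (s - l1norm y).+1) :: y.
have topP y : y \in C -> size (top y) = m.+1 /\ l1norm (top y) = s.+1.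
  by move=> /CP[sy ly]; rewrite l1norm_cons /= sy; split=> //; lia.
exists (B ++ map top C); split.
- rewrite cat_uniq uB map_inj_uniq ?uC ?andbT /=; last by move=> x y [].
  apply/hasPn => x /mapP[y /topP[_ ly] ->]; apply/negP => /BP[_].
  by rewrite ly ltnn.
- by rewrite size_cat size_map sB sC.
- by move=> x; rewrite mem_cat => /orP[/BP[]|/mapP[y /topP[? _] ->]].
have BC x y : x \in B -> y \in C -> l1dist m.+1 x (top y) <= s.*2.+1.
  move=> /BP[sx lx] /topP[sy ly].
  by have := l1dist_le sx sy; lia.
move=> x y; rewrite !mem_cat => /orP[xB|/mapP[x' xC ->]].
  case/orP=> [yB|/mapP[y' yC ->]]; last exact: BC.
  have [[sx lx] [sy ly]] := (BP _ xB, BP _ yB).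
  by have := l1dist_le sx sy; lia.
case/orP=> [yB|/mapP[y' yC ->]]; first by rewrite l1distC BC.
have [[sx lx] [sy ly]] := (CP _ xC, CP _ yC).
(* Norms alone would only give [2s + 2]. But the heads differ by the difference of the tail norms,
   and the tails by at most their sum: the total is at most twice the larger tail norm, so at most
   [2s]. *)
by rewrite l1dist_cons; have := l1dist_le sx sy; lia.
Qed.

Theorem theorem10 (m t : nat) (G : finZmodType) (n : nat) :
  0 < m -> 2 <= t ->
  #|G| = n ->
  (exists A : {set G}, #|A| = m /\ t_independent t A) ->
  q m t <= n.
Proof.
case: m => // m _ _ <- [A [cA indA]]; rewrite /q; case: ifP => t_odd.
  have [S [uS <- sizeS distS]] := l1diameter_odd_delannoy m t.-1./2.
  apply: (t_independent_size_le indA uS); rewrite cA // => x y xS yS.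
  by have := distS _ _ xS yS; lia.
have [S [uS <- SP]] := l1ball_delannoy m.+1 t./2.
apply: (t_independent_size_le indA uS); rewrite cA.
  by move=> x /SP[].
move=> x y /SP[sx lx] /SP[sy ly].
by have := l1dist_le sx sy; lia.
Qed.
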